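(* Let $r$ be a nonnegative integer and $\lambda\in\mathbb{R}$. For integers $n\ge k\ge0$, $${n+r+1 \brack k+r}_{r,\lambda}={n+r \brack k+r-1}_{r,\lambda}+(r+n-k\lambda){n+r \brack k+r}_{r,\lambda},$$ and $${n+r+1 \brace k+r}_{r,\lambda}={n+r \brace k+r-1}_{r,\lambda}+(r+k-n\lambda){n+r \brace k+r}_{r,\lambda}.$$
   Context: $(x)_{0,\lambda}=1$, $(x)_{n,\lambda}=x(x-\lambda)\cdots(x-(n-1)\lambda)$; $\langle x\rangle_{0,\lambda}=1$, $\langle x\rangle_{n,\lambda}=x(x+\lambda)\cdots(x+(n-1)\lambda)$; $(x)_n=(x)_{n,1}$, $\langle x\rangle_n=\langle x\rangle_{n,1}$. For $n\ge0$ and $0\le k\le n$, the unsigned degenerate $r$-Stirling numbers of the first kind are defined by $\langle x+r\rangle_n=\sum_{k=0}^n{n+r \brack k+r}_{r,\lambda}\langle x\rangle_{k,\lambda}$, and the degenerate $r$-Stirling numbers of the second kind by $(x+r)_{n,\lambda}=\sum_{k=0}^n{n+r \brace k+r}_{r,\lambda}(x)_k$ (polynomial identities in $x$); by convention ${n+r \brack k+r}_{r,\lambda}={n+r \brace k+r}_{r,\lambda}=0$ when $k<0$ or $k>n$. *)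

(* Defs.v *)
From HB Require Import structures.
From mathcomp Require Import all_boot all_order all_algebra.
From mathcomp Require Import mathcomp_extra boolp classical_sets reals.

Set Implicit Arguments.
Unset Strict Implicit.
Unset Printing Implicit Defensive.

Import Order.TTheory GRing.Theory Num.Theory.
Local Open Scope ring_scope.

Definition dfalling (A : comNzRingType) (lam x : A) (n : nat) : A :=
  \prod_(i < n) (x - i%:R * lam).

Definition drising (A : comNzRingType) (lam x : A) (n : nat) : A :=
  \prod_(i < n) (x + i%:R * lam).

(* [c] is the family of coefficients of the polynomial identity
   p = \sum_(0 <= k <= n) c_k b_k, extended by 0 to all integers k outside
   [0, n]. *)
Definition is_expansion (R : realType) (b : nat -> {poly R}) (p : {poly R})
    (n : nat) (c : int -> R) : Prop :=
  p = \sum_(k < n.+1) c k%:Z *: b k /\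
  (forall k : int, (k < 0) || (n%:Z < k) -> c k = 0).

(* The number with upper index n + r and lower index k + r in the usual
   notation; [rstirling1_spec] and [rstirling1_uniq] show that the defining
   identity determines it. The default value of [xget] is never used. *)
Definition rstirling1 (R : realType) (r : nat) (lam : R) (n : nat) :
    int -> R :=
  xget (fun _ : int => 0)
    [set c | is_expansion (drising lam%:P 'X) (drising 1 ('X + r%:R) n) n c]%classic.

(* Same indexing convention; see [rstirling2_spec] and [rstirling2_uniq]. *)
Definition rstirling2 (R : realType) (r : nat) (lam : R) (n : nat) :
    int -> R :=
  xget (fun _ : int => 0)
    [set c | is_expansion (dfalling 1 'X) (dfalling lam%:P ('X + r%:R) n) n c]%classic.

Section WellDefined.
Variable R : realType.
Implicit Types (b : nat -> {poly R}) (p : {poly R}) (c : int -> R).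

Lemma expansion_exists b p n :
  (forall k, b k \is monic) -> (forall k, size (b k) = k.+1) ->
  (size p <= n.+1)%N -> exists c, is_expansion b p n c.
Proof.
move=> bm bs sp.
suff [d pE] : exists d : nat -> R, p = \sum_(k < n.+1) d k *: b k.
  exists (fun k => if k is Posz m then if (m <= n)%N then d m else 0 else 0).
  split.
    rewrite pE; apply: eq_bigr => k _.
    by rewrite -ltnS ltn_ord.
  by case=> // m /=; rewrite ltz_nat ltnNge => /negbTE ->.
suff: forall m, (size p <= m)%N ->
    exists d : nat -> R, p = \sum_(k < m) d k *: b k by apply.
move=> m; elim: m p {sp} => [|m IH] p sp.
  exists (fun=> 0); rewrite big_ord0; apply/eqP.
  by rewrite -size_poly_eq0 -leqn0.
have [|d dE] := IH (p - p`_m *: b m).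
  apply/leq_sizeP => j; rewrite leq_eqVlt => /orP[/eqP <-|mj].
    have := monicP (bm m); rewrite lead_coefE bs /= => bmm.
    by rewrite coefB coefZ bmm mulr1 subrr.
  rewrite coefB coefZ (nth_default _ (leq_trans sp mj)).
  by rewrite (nth_default _ (s := b m)) ?bs // mulr0 subr0.
exists (fun k => if k == m then p`_m else d k).
rewrite big_ord_recr /= eqxx.
under eq_bigr => i _ do rewrite (ltn_eqF (ltn_ord i)).
by rewrite -dE subrK.
Qed.

Lemma free_expansion b n (d : nat -> R) :
  (forall k, size (b k) = k.+1) ->
  \sum_(k < n) d k *: b k = 0 -> forall k, (k < n)%N -> d k = 0.
Proof.
move=> bs; elim: n => // n IH; rewrite big_ord_recr /= => s0.
have dn : d n = 0.
  have := congr1 (fun p : {poly R} => p`_n) s0.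
  rewrite coefD coef_sum big1 => [|i _]; last first.
    by rewrite coefZ nth_default ?mulr0 // bs.
  rewrite add0r coefZ coef0 => /eqP; rewrite mulf_eq0 => /orP[/eqP //|].
  have := lead_coef_eq0 (b n); rewrite lead_coefE bs /= => ->.
  by rewrite -size_poly_eq0 bs.
move: s0; rewrite dn scale0r addr0 => /IH s0 k.
by rewrite ltnS leq_eqVlt => /orP[/eqP -> //|/s0].
Qed.

Lemma expansion_uniq b p n c c' :
  (forall k, size (b k) = k.+1) ->
  is_expansion b p n c -> is_expansion b p n c' -> c = c'.
Proof.
move=> bs [pE c0] [pE' c0']; apply/funext => k.
case: (boolP ((k < 0) || (n%:Z < k))) => [ko|]; first by rewrite c0 ?c0'.
case: k => // k; rewrite /= ltz_nat -leqNgt => kn.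
apply/eqP; rewrite -subr_eq0; apply/eqP.
apply: (@free_expansion b n.+1 (fun k => c k%:Z - c' k%:Z)) => //.
under eq_bigr => i _ do rewrite scalerBl.
by rewrite sumrB -pE -pE' subrr.
Qed.

Lemma drising_poly (lam a : R) n :
  drising lam%:P ('X + a%:P) n = \prod_(i < n) ('X - (- (a + i%:R * lam))%:P).
Proof.
by apply: eq_bigr => i _; rewrite polyCN opprK polyCD polyCM polyC_natr addrA.
Qed.

Lemma dfalling_poly (lam a : R) n :
  dfalling lam%:P ('X + a%:P) n = \prod_(i < n) ('X - (i%:R * lam - a)%:P).
Proof.
apply: eq_bigr => i _.
by rewrite polyCB polyCM polyC_natr opprB addrCA addrA [a%:P + _]addrC.
Qed.

Lemma monic_drising (lam a : R) n : drising lam%:P ('X + a%:P) n \is monic.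
Proof. by rewrite drising_poly monic_prod_XsubC. Qed.

Lemma monic_dfalling (lam a : R) n : dfalling lam%:P ('X + a%:P) n \is monic.
Proof. by rewrite dfalling_poly monic_prod_XsubC. Qed.

Lemma size_drising (lam a : R) n : size (drising lam%:P ('X + a%:P) n) = n.+1.
Proof. by rewrite drising_poly size_prod_XsubC /index_enum -enumT size_enum_ord. Qed.

Lemma size_dfalling (lam a : R) n : size (dfalling lam%:P ('X + a%:P) n) = n.+1.
Proof. by rewrite dfalling_poly size_prod_XsubC /index_enum -enumT size_enum_ord. Qed.

Lemma rstirling1_spec r (lam : R) n :
  is_expansion (drising lam%:P 'X) (drising 1 ('X + r%:R) n) n
    (rstirling1 r lam n).
Proof.
have [|||c cP] := @expansion_exists (drising lam%:P 'X)
  (drising 1 ('X + r%:R) n) n.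
- by move=> k; rewrite -['X]addr0 monic_drising.
- by move=> k; rewrite -['X]addr0 size_drising.
- by rewrite -polyC_natr -polyC1 size_drising.
exact: (@xgetI _ (fun=> 0) [set c | is_expansion _ _ _ c]%classic c cP).
Qed.

Lemma rstirling2_spec r (lam : R) n :
  is_expansion (dfalling 1 'X) (dfalling lam%:P ('X + r%:R) n) n
    (rstirling2 r lam n).
Proof.
have [|||c cP] := @expansion_exists (dfalling 1 'X)
  (dfalling lam%:P ('X + r%:R) n) n.
- by move=> k; rewrite -['X]addr0 -polyC1 monic_dfalling.
- by move=> k; rewrite -['X]addr0 -polyC1 size_dfalling.
- by rewrite -polyC_natr size_dfalling.
exact: (@xgetI _ (fun=> 0) [set c | is_expansion _ _ _ c]%classic c cP).
Qed.

Lemma rstirling1_uniq r (lam : R) n c :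
  is_expansion (drising lam%:P 'X) (drising 1 ('X + r%:R) n) n c ->
  c = rstirling1 r lam n.
Proof.
move=> cP; apply: expansion_uniq cP (rstirling1_spec _ _ _) => k.
by rewrite -['X]addr0 size_drising.
Qed.

Lemma rstirling2_uniq r (lam : R) n c :
  is_expansion (dfalling 1 'X) (dfalling lam%:P ('X + r%:R) n) n c ->
  c = rstirling2 r lam n.
Proof.
move=> cP; apply: expansion_uniq cP (rstirling2_spec _ _ _) => k.
by rewrite -['X]addr0 -polyC1 size_dfalling.
Qed.

End WellDefined.

(* Main.v *)
(** Multiplying an expansion in a basis with [b (k + 1) = b k * (X + e k)] by
    [X + s = (X + e k) + (s - e k)] sends the coefficient [c k] to
    [c (k - 1) + (s - e k) * c k]. Both recurrences are instances, since the
    expanded products grow by one such linear factor and expansions are unique. *)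
Require Import Defs.
From HB Require Import structures.
From mathcomp Require Import all_boot all_order all_algebra.
From mathcomp Require Import zify.
From mathcomp Require Import reals.

Set Implicit Arguments.
Unset Strict Implicit.
Unset Printing Implicit Defensive.

Import Order.TTheory GRing.Theory Num.Theory.
Local Open Scope ring_scope.

(** The absolute value carries [e] over to integer indices; at negative [k] its factor [c k] is
    zero. *)
Lemma is_expansion_mulXD (R : realType) (b : nat -> {poly R}) (e : nat -> R)
    (p : {poly R}) (s : R) (n : nat) (c : int -> R) :
  (forall k, b k.+1 = b k * ('X + (e k)%:P)) -> is_expansion b p n c ->
  is_expansion b (p * ('X + s%:P)) n.+1
    (fun k => c (k - 1) + (s - e `|k|%N) * c k).
Proof.
move=> bS [pE c0]; split=> [|k ko]; last first.
  by rewrite !c0 ?mulr0 ?addr0 //; lia.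
under eq_bigr => k _ do rewrite scalerDl.
(* Since [c] vanishes at [-1] and [n + 1], the first sum loses its bottom term and the second its
   top term; reindexed, both run over [k <= n]. *)
rewrite big_split /= big_ord_recl (c0 (0%N%:Z - 1)) // scale0r add0r.
rewrite [X in _ = _ + X]big_ord_recr /= (c0 n.+1%:Z) ?ltz_nat ?ltnS ?leqnn ?orbT //.
rewrite mulr0 scale0r addr0 -big_split pE mulr_suml /=.
apply: eq_bigr => k _.
have -> : (bump 0 k)%:Z - 1 = k%:Z by rewrite /bump; lia.
rewrite [b (bump 0 k)]bS mulrC [_ * c _]mulrC -scalerA -scalerDr -scalerAr.
congr (_ *: _).
by rewrite -mul_polyC polyCB [b k * _]mulrC -mulrDl addrA addrAC addrK.
Qed.

Lemma drisingS (A : comNzRingType) (lam x : A) (n : nat) :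
  drising lam x n.+1 = drising lam x n * (x + n%:R * lam).
Proof. exact: big_ord_recr. Qed.

Lemma dfallingS (A : comNzRingType) (lam x : A) (n : nat) :
  dfalling lam x n.+1 = dfalling lam x n * (x - n%:R * lam).
Proof. exact: big_ord_recr. Qed.

Theorem theorem8 (R : realType) (r : nat) (lam : R) (n k : nat)
    (hk : (k <= n)%N) :
  rstirling1 r lam n.+1 k%:Z =
    rstirling1 r lam n (k%:Z - 1)
    + (r%:R + n%:R - k%:R * lam) * rstirling1 r lam n k%:Z
  /\
  rstirling2 r lam n.+1 k%:Z =
    rstirling2 r lam n (k%:Z - 1)
    + (r%:R + k%:R - n%:R * lam) * rstirling2 r lam n k%:Z.
Proof.
split.
  have bS j : drising lam%:P 'X j.+1
      = drising lam%:P 'X j * ('X + (j%:R * lam)%:P).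
    by rewrite drisingS polyCM polyC_natr.
  (* The new factor of the rising product is ['X + r + n * 1]. *)
  have := is_expansion_mulXD (r%:R + n%:R) bS (rstirling1_spec r lam n).
  rewrite polyCD !polyC_natr addrA -[n%:R in X in is_expansion _ X]mulr1.
  by rewrite -drisingS => /rstirling1_uniq <-.
(* Here [e k] is [- k] and the new factor is ['X + r - n * lam], so [s - e k] is
   [r - n * lam + k]. *)
have bS j : dfalling 1 'X j.+1 = dfalling 1 'X j * ('X + (- j%:R : R)%:P).
  by rewrite dfallingS mulr1 polyCN polyC_natr.
have := is_expansion_mulXD (r%:R - n%:R * lam) bS (rstirling2_spec r lam n).
rewrite polyCB polyCM !polyC_natr addrA -dfallingS => /rstirling2_uniq <-.
by rewrite opprK addrAC.
Qed.
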